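(* Let $\mathbb{G}$ be a Polish group and suppose there are sets $B_k$, $A_k^j$ ($j,k\in\omega$) such that: (1) all $B_k$ and $A_k^j$ are subsets of $G$; (2) there is an infinite branching tree $T\subseteq\omega^{<\omega}$ such that $\bigcap_{k\in\omega}A_k^{b(k)}\neq\emptyset$ for every $b\in[T]$; (3) $\bigcup_{k\in\omega}B_k$ is dense open in $G$; (4) $(A_k^iB_k)\cap(A_k^jB_k)=\emptyset$ whenever $i\neq j$. Then $\mathrm{cov}_{\mathbb{G}}=\mathrm{cov}(\mathcal{M})$.
   Context: For $A,B\subseteq G$, $AB=\{ab:a\in A,b\in B\}$. $\mathrm{cov}_{\mathbb{G}}$ is the least cardinality of a set $Q\subseteq G$ such that there is a closed nowhere dense $C\subseteq G$ with $QC=G$. $\mathrm{cov}(\mathcal{M})$ is the least cardinality of a family of meagre subsets of $\mathbb{R}$ covering $\mathbb{R}$. A tree $T\subseteq\omega^{<\omega}$ is a set of finite sequences of naturals closed under initial segments; $[T]=\{f\in\omega^\omega: f\restriction n\in T\ \forall n\}$; $T$ is infinite branching if for each $t\in T$ the set $\{n: t^\frown(n)\in T\}$ is infinite. *)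

(* Defs.v *)
From HB Require Import structures.
From mathcomp Require Import all_boot all_order all_algebra.
From mathcomp Require Import all_classical all_reals all_analysis.

Set Implicit Arguments.
Unset Strict Implicit.
Unset Printing Implicit Defensive.

Import numFieldNormedType.Exports.
Local Open Scope classical_set_scope.
Local Open Scope card_scope.
Local Open Scope ring_scope.

HB.mixin Record Group_Topological_isTopologicalGroup G
    & Group G & Topological G := {
  mulg_continuous : continuous (fun xy : G * G => (xy.1 * xy.2)%g) ;
  invg_continuous : continuous (fun x : G => (x^-1)%g)
}.

#[short(type="topologicalGroupType")]
HB.structure Definition TopologicalGroup :=
  {G of Group G & Topological G & Group_Topological_isTopologicalGroup G}.

Record is_metric (R : realType) (T : Type) (d : T -> T -> R) : Prop := {
  is_metric_ge0 : forall x y, 0 <= d x y ;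
  is_metric_eq0 : forall x y, d x y = 0 <-> x = y ;
  is_metric_sym : forall x y, d x y = d y x ;
  is_metric_triangle : forall x y z, d x z <= d x y + d y z
}.

Definition metric_induces_topology (R : realType) (T : topologicalType)
    (d : T -> T -> R) : Prop :=
  forall x : T, nbhs x =
    filter_from [set e : R | 0 < e] (fun e => [set y | d x y < e]).

Definition metric_complete (R : realType) (T : topologicalType)
    (d : T -> T -> R) : Prop :=
  forall u : nat -> T,
    (forall e : R, 0 < e -> exists N : nat,
       forall m n : nat, (N <= m)%N -> (N <= n)%N -> d (u m) (u n) < e) ->
    exists l : T, u @ \oo --> l.

Definition completely_metrizable (R : realType) (T : topologicalType) : Prop :=
  exists d : T -> T -> R,
    [/\ is_metric d, metric_induces_topology d & metric_complete d].

Definition separable_space (T : topologicalType) : Prop :=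
  exists D : set T, countable D /\ dense D.

Definition polish_space (R : realType) (T : topologicalType) : Prop :=
  separable_space T /\ completely_metrizable R T.

Definition nowhere_dense (T : topologicalType) (A : set T) : Prop :=
  (closure A)° = set0.

Definition meagre (T : topologicalType) (A : set T) : Prop :=
  exists F : nat -> set T,
    (forall n, nowhere_dense (F n)) /\ A = \bigcup_n F n.

Definition set_mulg (G : groupType) (A B : set G) : set G :=
  [set (a * b)%g | a in A & b in B].

Definition least_cardinality (T : Type) (P : set (set T)) (A : set T) : Prop :=
  P A /\ forall B : set T, P B -> A #<= B.

(* Cardinal numbers are represented by sets up to equipotency: [is_cov_group Q]
   says that Q is a witness of least cardinality, so |Q| = cov_G. *)
Definition is_cov_group (G : topologicalGroupType) (Q : set G) : Prop :=
  least_cardinality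
    [set Q' : set G | exists C : set G,
       [/\ closed C, nowhere_dense C & set_mulg Q' C = [set: G]]] Q.

(* Likewise, |F| = cov(M). *)
Definition is_cov_meagre (R : realType) (F : set (set R)) : Prop :=
  least_cardinality
    [set F' : set (set R) |
       (forall A, F' A -> meagre A) /\ \bigcup_(A in F') A = [set: R]] F.

Definition is_tree (T : set (seq nat)) : Prop :=
  forall s t : seq nat, prefix s t -> T t -> T s.

Definition tree_body (T : set (seq nat)) : set (nat -> nat) :=
  [set f | forall n, T (mkseq f n)].

Definition infinite_branching (T : set (seq nat)) : Prop :=
  forall t, T t -> infinite_set [set n | T (rcons t n)].

(* Main.v *)
Require Import Defs.
From HB Require Import structures.
From mathcomp Require Import all_boot all_order all_algebra.
From mathcomp Require Import all_classical all_reals all_analysis.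
From mathcomp Require finmap.
From mathcomp Require Import zify lra.

(** Both cardinals equal the least cardinality of a set [Q] that is not
    [meetable], i.e. that indexes a family of functions [nat -> nat] such that
    no single function agrees with each of them somewhere.
    - A cover of a nonempty Polish space by meagre sets indexed by [Q] shows
      that [Q] is not meetable (Bartoszynski): otherwise one could guess a
      sequence of shrinking balls whose limit avoids all the meagre sets. This
      applies to the reals and to the cover of [G] by translates of [C].
    - If [Q] is not meetable, the reals are covered by nowhere dense sets indexed
      by [Q], and the hypotheses on [A], [B] and the tree yield translations of
      the complement of the union of the [B k], indexed by [Q], that cover [G]:
      an uncovered point [g] lies, for each [k], in at most one [A k i * B k],
      and the map sending [k] to this [i] would agree somewhere with each of the
      branches chosen. *)

Set Implicit Arguments.
Unset Strict Implicit.
Unset Printing Implicit Defensive.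

Import Order.TTheory GRing.Theory Num.Theory numFieldNormedType.Exports.
Local Open Scope classical_set_scope.
Local Open Scope card_scope.

(** * Index sets whose families of functions can be guessed *)

Definition meetable (T : Type) (Q : set T) : Prop :=
  forall Phi : T -> nat -> nat,
  exists g : nat -> nat, forall q, Q q -> exists k, g k = Phi q k.

(** Each slice at a fixed [N] is guessed separately, and the guesses are interleaved by the coding
    of pairs. This later splits meagre sets into nowhere dense ones. *)
Lemma meetable_setX_nat (T : Type) (Q : set T) :
  meetable Q -> meetable (Q `*` [set: nat]).
Proof.
move=> meetQ Phi.
have /choice[g gP] N := meetQ (fun q k => Phi (q, N) (pickle (N, k))).
exists (fun m => if unpickle m is Some (N, k) then g N k else 0%N).
move=> [q N] /= [Qq _]; have [k gk] := gP N q Qq.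
by exists (pickle (N, k)); rewrite pickleK.
Qed.

(** Guessing the shift of [psi] by [N] yields a hit at a place not below [N]; at each place [m], the
    maximum over the shifts [N <= m] serves every [N] at once. *)
Lemma meetable_unbounded (T : Type) (Q : set T) (psi : T -> nat -> nat) :
  meetable Q ->
  exists g : nat -> nat, forall q, Q q ->
    forall N, exists2 n, (N <= n)%N & (psi q n <= g n)%N.
Proof.
move=> meetQ.
have /choice[g gP] N := meetQ (fun q k => psi q (N + k)%N).
exists (fun m => \max_(N < m.+1) g N (m - N)%N) => q Qq N.
have [k gk] := gP N q Qq; exists (N + k)%N; first exact: leq_addr.
have ltN : (N < (N + k).+1)%N by rewrite ltnS leq_addr.
rewrite -gk -[in X in (X <= _)%N](addKn N k).
exact: (leq_bigmax (Ordinal ltN)).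
Qed.

(* Greedy choice of pairs of L 0, L 1, ... with distinct first components. *)
Fixpoint sdr (L : nat -> seq (nat * nat)) (n : nat) : seq (nat * nat) :=
  if n is m.+1 then
    let s := sdr L m in
    take 1 [seq p <- L m | p.1 \notin unzip1 s] ++ s
  else [::].

Lemma size_sdr L n : (size (sdr L n) <= n)%N.
Proof.
elim: n => //= n IH; rewrite size_cat -[n.+1]add1n leq_add //.
by rewrite size_take_min geq_minl.
Qed.

Lemma sdr_mono L m n : (m <= n)%N -> {subset sdr L m <= sdr L n}.
Proof.
move=> /subnKC <-; elim: (n - m)%N => [|k IH] p; first by rewrite addn0.
by move=> /IH; rewrite addnS /= mem_cat => ->; rewrite orbT.
Qed.

Lemma uniq_sdr L n : uniq (unzip1 (sdr L n)).
Proof.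
elim: n => //= n IH; rewrite /unzip1 map_cat.
case E: [seq p <- L n | _] => [|p s] //=.
have : p \in [seq p <- L n | p.1 \notin unzip1 (sdr L n)] by rewrite E mem_head.
by rewrite take0 /= mem_filter IH andbT => /andP[].
Qed.

Lemma sdr_functional L m n k v v' :
  (k, v) \in sdr L m -> (k, v') \in sdr L n -> v = v'.
Proof.
move=> /(sdr_mono (leq_maxl m n)) h1 /(sdr_mono (leq_maxr m n)) h2.
elim: (sdr L _) (uniq_sdr L (maxn m n)) h1 h2 => //= p s IH /andP[pNs us].
rewrite !inE => /orP[/eqP pE|h1] /orP[/eqP pE'|h2].
- by have := etrans pE (esym pE'); case.
- by have /negP[] := pNs; apply/mapP; exists (k, v'); rewrite // -pE.
- by have /negP[] := pNs; apply/mapP; exists (k, v); rewrite // -pE'.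
- exact: IH.
Qed.

(** Pigeonhole: at most [n] first components are taken before stage [n], and [L n] offers more. *)
Lemma sdr_hit L n : uniq (unzip1 (L n)) -> (n < size (L n))%N ->
  exists2 p, p \in L n & p \in sdr L n.+1.
Proof.
move=> uL sL /=; case E: [seq p <- L n | _] => [|p s] /=.
  have : (size (unzip1 (L n)) <= size (unzip1 (sdr L n)))%N.
    apply: uniq_leq_size => // k /mapP[p pL ->]; apply: contraT => pN.
    by have : p \in [::] by rewrite -E mem_filter pN.
  by rewrite !size_map; have := size_sdr L n; lia.
exists p; last exact: mem_head.
have : p \in [seq p <- L n | p.1 \notin unzip1 (sdr L n)] by rewrite E mem_head.
by rewrite mem_filter => /andP[].
Qed.

Lemma distinct_representatives (L : nat -> seq (nat * nat)) :
  exists f : nat -> nat, forall n, uniq (unzip1 (L n)) ->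
    (n < size (L n))%N -> exists2 p, p \in L n & f p.1 = p.2.
Proof.
exists (fun k => xget 0%N [set v | exists n, (k, v) \in sdr L n]) => n uL sL.
have [[k v] pL ps] := sdr_hit uL sL; exists (k, v) => //=.
case: xgetP => [v' _ [m vs]|/(_ v)[]]; last by exists n.+1.
exact: sdr_functional vs ps.
Qed.

(* The n-th guess is about the first n + 1 elements of X q: this leaves room to
   extract from correct guesses made at distinct n values at distinct places. *)
Lemma meetable_on_infinite (T : Type) (Q : set T) (X : T -> set nat)
    (y : T -> nat -> nat) :
  meetable Q ->
  (forall q, Q q -> forall N, exists2 n, (N <= n)%N & X q n) ->
  exists g : nat -> nat, forall q, Q q -> exists2 k, X q k & g k = y q k.
Proof.
move=> meetQ Xinf.
have /choice[nx nxP] : forall q, exists f : nat -> nat,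
    Q q -> forall N, (N <= f N)%N /\ X q (f N).
  move=> q; have [Qq|nQq] := pselect (Q q); last by exists id.
  have /choice[f fP] : forall N, exists n, (N <= n)%N /\ X q n.
    by move=> N; have [n ? ?] := Xinf q Qq N; exists n.
  by exists f.
pose e q := fix e n := if n is m.+1 then nx q (e m).+1 else nx q 0%N.
have eX q : Q q -> forall n, X q (e q n) by move=> Qq [|n]; apply nxP.
have e_inj q : Q q -> injective (e q).
  move=> Qq; have e_lt m n : (m < n)%N -> (e q m < e q n)%N.
    elim: n => // n IH; rewrite ltnS leq_eqVlt => /orP[/eqP ->|/IH h] /=;
      by have [] := nxP q Qq (e q n).+1; lia.
  by move=> m n eE; case: (ltngtP m n) => // /e_lt; rewrite eE ltnn.
pose h q n := [seq (e q i, y q (e q i)) | i <- iota 0 n.+1].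
have [g gP] := meetQ (fun q n => pickle (h q n)).
pose L n : seq (nat * nat) := odflt [::] (unpickle (g n)).
have [f fP] := distinct_representatives L; exists f => q Qq.
have [n gn] := gP q Qq.
have Ln : L n = h q n by rewrite /L gn pickleK.
have [||p] := fP n.
- by rewrite Ln /h /unzip1 -map_comp map_inj_uniq ?iota_uniq //; exact: e_inj.
- by rewrite Ln size_map size_iota.
by rewrite Ln => /mapP[i _ ->] /= fe; exists (e q i); first exact: eX.
Qed.

(** * Bartoszynski's theorem *)

Section Game.
Variables (P : choiceType) (p0 : P) (step : P -> nat -> P).

(** The one number [m] bounds both the length of a run and its instructions, which keeps the list
    finite. *)
Fixpoint reach (m : nat) : seq P :=
  if m is k.+1 then
    reach k ++ [seq step p i | p <- reach k, i <- iota 0 k.+1]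
  else [:: p0].

Lemma reach_mono m n : (m <= n)%N -> {subset reach m <= reach n}.
Proof.
move=> /subnKC <-; elim: (n - m)%N => [|k IH] p; first by rewrite addn0.
by move=> /IH; rewrite addnS /= mem_cat => ->.
Qed.

Lemma reach_step m p i : p \in reach m -> (i <= m)%N -> step p i \in reach m.+1.
Proof.
move=> pm im; rewrite [reach _]/reach -/reach mem_cat; apply/orP; right.
by apply/allpairsPdep; exists p, i; split=> //; rewrite mem_iota add0n ltnS.
Qed.

(* Bartoszynski's characterisation of cov(M), for the forcing notion of finite
   runs. A first guess g bounds the instructions, so that at stage n only
   finitely many positions are possible; being unbounded, g leaves for each q
   infinitely many stages at which some instruction allowed by g leads from all
   possible positions into D q, and a second guess picks it at one of them. *)
Lemma meetable_run (T : Type) (Q : set T) (D : T -> set P) :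
  meetable Q ->
  (forall q, Q q -> forall W : seq P, exists i, forall p, p \in W -> D q (step p i)) ->
  exists p : nat -> P,
    [/\ p 0%N = p0, forall n, exists i, p n.+1 = step (p n) i &
        forall q, Q q -> exists n, D q (p n)].
Proof.
move=> meetQ Ddense.
have /choice[c cP] : forall q, exists c : nat -> nat, Q q ->
    forall m p, p \in reach m -> D q (step p (c m)).
  move=> q; have [Qq|nQq] := pselect (Q q); last by exists id.
  by have /choice[c cP] := fun m => Ddense q Qq (reach m); exists c.
pose cm q m := \max_(j < m.+1) c q j.
have c_cm q m : (c q m <= cm q m)%N.
  exact: (leq_bigmax (Ordinal (ltnSn m))).
have cm_mono q m n : (m <= n)%N -> (cm q m <= cm q n)%N.
  move=> mn; apply/bigmax_leqP => i _.
  have ni : (i < n.+1)%N by have := ltn_ord i; lia.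
  exact: (leq_bigmax (Ordinal ni)).
pose phi q m := (maxn m (cm q m)).+1.
have phi_mono q m n : (m <= n)%N -> (phi q m <= phi q n)%N.
  by move=> mn; rewrite ltnS geq_max !leq_max mn cm_mono ?orbT.
have iter_mono q k l a b : (k <= l)%N -> (a <= b)%N ->
    (iter k (phi q) a <= iter l (phi q) b)%N.
  move=> kl ab; apply: (@leq_trans (iter k (phi q) b)).
    by elim: k {kl} => //= k IH; exact: phi_mono.
  rewrite -(subnK kl) iterD; elim: (l - k)%N => //= j IH.
  by apply: leq_trans IH _; rewrite /phi; lia.
have [g gP] := meetable_unbounded (fun q n => cm q (iter n (phi q) n)) meetQ.
(* With instructions bounded by [g], the position at stage [n] stays in [reach (w n)]. *)
pose w := fix w n := if n is m.+1 then (maxn (w m) (g m)).+1 else 0%N.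
have Xinf q : Q q -> forall N, exists2 n, (N <= n)%N & (c q (w n) <= g n)%N.
  (* If [g n < c q (w n)] for all [n >= N], then [w] grows no faster than the iterates of [phi q],
     so [w n <= iter n (phi q) n] for large [n]; but [g n] is at least [cm q] of the latter for
     infinitely many [n]. *)
  move=> Qq N; apply: contrapT => Xfin.
  have gc n : (N <= n)%N -> (g n < c q (w n))%N.
    by move=> Nn; rewrite ltnNge; apply/negP => cg; apply: Xfin; exists n.
  have wle k : (w (N + k) <= iter k (phi q) (w N))%N.
    elim: k => [|k IH]; first by rewrite addn0.
    rewrite addnS /=; apply: leq_trans (phi_mono q _ _ IH).
    have := gc (N + k)%N (leq_addr _ _); have := c_cm q (w (N + k)%N).
    by rewrite /phi; lia.
  have [n nN gn] := gP q Qq (maxn N (w N)).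
  have /subnKC nE : (N <= n)%N by lia.
  have := gc n; have := wle (n - N)%N; rewrite nE => wn /(_ ltac:(lia)) gn'.
  have itl : (iter (n - N) (phi q) (w N) <= iter n (phi q) n)%N.
    by apply: iter_mono; lia.
  have := cm_mono q _ _ (leq_trans wn itl); have := c_cm q (w n); lia.
have [g' g'P] := @meetable_on_infinite _ Q
  (fun q n => (c q (w n) <= g n)%N) (fun q n => c q (w n)) meetQ Xinf.
(* The cap by [g] keeps the run inside [reach (w n)] and is void where [g'] correctly guesses an
   instruction allowed by [g]. *)
pose p := fix p n := if n is m.+1 then step (p m) (minn (g' m) (g m)) else p0.
exists p; split=> // [n|q Qq]; first by exists (minn (g' n) (g n)).
have pw n : p n \in reach (w n).
  elim: n => [|n IH]; first exact: mem_head.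
  apply: (@reach_step (maxn (w n) (g n))).
    by apply: reach_mono IH; exact: leq_maxl.
  by rewrite geq_min !leq_max leqnn !orbT.
have [k cg g'k] := g'P q Qq; exists k.+1 => /=.
by rewrite g'k (minn_idPl cg); exact: cP.
Qed.

End Game.

Local Open Scope ring_scope.

(** * Covers of Polish spaces *)

Section BallGame.
Variables (R : realType) (X : topologicalType) (d : X -> X -> R) (c : nat -> X).
Hypotheses (dP : is_metric d) (dtop : metric_induces_topology d).
Hypothesis dcomp : metric_complete d.
Hypothesis cdense : forall V : set X, open V -> V !=set0 -> exists n, V (c n).

Let rad (k : nat) : R := k.+1%:R^-1.

Let rad_gt0 k : 0 < rad k. Proof. by rewrite invr_gt0 ltr0n. Qed.

Let rad_le m k : (k <= m)%N -> rad m <= rad k.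
Proof. by move=> km; rewrite lef_pV2 ?posrE ?ltr0n // ler_nat. Qed.

Let rad_small (e : R) : 0 < e -> exists k, rad k < e.
Proof.
move=> e0; have [k _ kP] := near_infty_natSinv_lt (PosNum e0).
by exists k; apply: (kP k) => /=.
Qed.

Let mball (p : X * nat) : set X := [set y | d p.1 y < rad p.2].

(** A closed ball inside an open one, so that limits of centres stay inside; the index grows
    strictly, so that the radii along a run tend to 0. *)
Let refines (p' p : X * nat) : Prop :=
  (p.2 < p'.2)%N /\ [set y | d p'.1 y <= rad p'.2] `<=` mball p.

Let refines_mball p' p : refines p' p -> mball p' `<=` mball p.
Proof. by move=> [_ h] y /ltW; exact: h. Qed.

Let refines_trans p q r : refines p q -> refines q r -> refines p r.
Proof.
move=> [h1 s1] [h2 s2]; split; first exact: ltn_trans h1.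
by move=> y /s1 /ltW; exact: s2.
Qed.

Let refines_self x k : refines (x, k.+1) (x, k).
Proof.
split=> //= y /= /le_lt_trans; apply.
by rewrite ltf_pV2 ?posrE ?ltr0n // ltr_nat.
Qed.

Let dxx x : d x x = 0. Proof. exact/(is_metric_eq0 dP). Qed.

(* An instruction i codes a ball (c n, 1/(k+1)), ignored unless it refines p. *)
Let step1 (p : X * nat) (i : nat) : X * nat :=
  if unpickle i is Some (n, k) then
    if asbool (refines (c n, k) p) then (c n, k) else (p.1, p.2.+1)
  else (p.1, p.2.+1).

Let step1_refines p i : refines (step1 p i) p.
Proof.
rewrite /step1; case: p => x k; have rxk := refines_self x k.
by case: unpickle => // -[n m]; case: asboolP.
Qed.

(** One move executes a whole list, so that it can treat finitely many positions in turn; the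
    initial [step1 p 0] makes even the empty list refine [p]. *)
Let step (p : X * nat) (i : nat) : X * nat :=
  foldl step1 (step1 p 0%N) (odflt [::] (unpickle i)).

Let foldl_refines s p : foldl step1 p s = p \/ refines (foldl step1 p s) p.
Proof.
elim: s p => [|i s IH] p /=; [by left|right].
have [->|h] := IH (step1 p i); first exact: step1_refines.
exact: refines_trans h (step1_refines p i).
Qed.

Let step_refines p i : refines (step p i) p.
Proof.
rewrite /step; set s := odflt _ _.
have [->|h] := foldl_refines s (step1 p 0%N); first exact: step1_refines.
exact: refines_trans h (step1_refines _ _).
Qed.

Let foldl_mball s p : mball (foldl step1 p s) `<=` mball p.
Proof. by case: (foldl_refines s p) => [->//|]; exact: refines_mball. Qed.

Let nbhs_dball x e : 0 < e -> nbhs x [set y | d x y < e].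
Proof. by move=> e0; rewrite dtop; exists e. Qed.

Let mball_open p : open (mball p).
Proof.
rewrite openE => x /= px; rewrite /interior dtop.
exists (rad p.2 - d p.1 x) => /= [|y /= xy]; first by rewrite subr_gt0.
by apply: le_lt_trans (is_metric_triangle dP _ x _) _; lra.
Qed.

Let step1_avoids (N : set X) p : nowhere_dense N ->
  exists i, mball (step1 p i) `&` N = set0.
Proof.
move=> nwd; pose V := mball p `&` ~` closure N.
have Vo : open V by apply: openI => //; exact/closed_openC/closed_closure.
have [y Vy] : V !=set0.
  apply/set0P/negP => /eqP V0.
  have : mball p `<=` (closure N)°.
    rewrite -open_subsetE // => y py; apply: contrapT => Ny.
    by have : V y by []; rewrite V0.
  by rewrite nwd => /(_ p.1); apply; rewrite /mball /= dxx.
have [e /= e0 eV] : filter_from [set e : R | 0 < e] (fun e => [set y' | d y y' < e]) V.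
  by rewrite -dtop; exact: open_nbhs_nbhs.
have [k ke] := rad_small (divr_gt0 e0 (ltr0Sn R 1)).
pose m := maxn k p.2.+1.
have mk : rad m <= rad k by apply: rad_le; rewrite leq_maxl.
have [n cn] : exists n, mball (y, m) (c n).
  by apply: cdense => //; exists y; rewrite /mball /= dxx.
rewrite /mball /= in cn.
have cV z : d (c n) z <= rad m -> V z.
  move=> cz; apply: eV => /=.
  by apply: le_lt_trans (is_metric_triangle dP _ (c n) _) _; lra.
exists (pickle (n, m)); rewrite /step1 pickleK.
have -> : asbool (refines (c n, m) p).
  apply/asboolP; split=> /= [|z /cV[]//]; first by rewrite /m; lia.
apply/seteqP; split=> // z [/= /ltW /cV[_ Nz] /subset_closure].
exact: Nz.
Qed.

Let step_avoids (N : set X) (W : seq (X * nat)) : nowhere_dense N ->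
  exists i, forall p, p \in W -> mball (step p i) `&` N = set0.
Proof.
move=> nwd.
suff [s sP] : exists s, forall p, p \in W ->
    mball (foldl step1 (step1 p 0%N) s) `&` N = set0.
  by exists (pickle s) => p pW; rewrite /step pickleK; exact: sP.
elim: W => [|p W [s sP]]; first by exists [::].
have [i iP] := step1_avoids (foldl step1 (step1 p 0%N) s) nwd.
(* Further instructions only shrink balls, so what [s] achieved for [W] survives. *)
exists (rcons s i) => p'; rewrite inE foldl_rcons => /orP[/eqP ->//|/sP p'0].
apply/seteqP; split=> // z [/(refines_mball (step1_refines _ _)) h Nz].
by rewrite -p'0.
Qed.

Let run_point (p : nat -> X * nat) :
  (forall n, refines (p n.+1) (p n)) -> exists l, forall n, mball (p n) l.
Proof.
move=> pS.
have pm m n : (m < n)%N -> refines (p n) (p m).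
  elim: n => // n IH; rewrite ltnS leq_eqVlt => /orP[/eqP ->//|/IH].
  exact: refines_trans.
have pc n : mball (p n) (p n).1 by rewrite /mball /= dxx.
have pmc m n : (m <= n)%N -> mball (p m) (p n).1.
  rewrite leq_eqVlt => /orP[/eqP ->//|/pm/refines_mball]; exact.
have pk n : (n <= (p n).2)%N.
  by elim: n => // n IH; have [] := pS n; lia.
have [l lP] : exists l : X, (fun n => (p n).1) @ \oo --> l.
  apply: dcomp => e e0; have [k ke] := rad_small (divr_gt0 e0 (ltr0Sn R 1)).
  exists k => m n km kn; have := rad_le (pk k) => rk.
  have := pmc _ _ km; have := pmc _ _ kn; rewrite /mball /= => h1 h2.
  apply: le_lt_trans (is_metric_triangle dP _ (p k).1 _) _.
  by rewrite (is_metric_sym dP (p m).1); lra.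
exists l => n; have [_ h] := pS n; apply: h => /=.
apply/ler_addgt0Pr => e e0.
have [M _ MP] := lP _ (nbhs_dball l e0).
pose m := maxn M n.+1.
have := pmc n.+1 m (leq_maxr _ _); rewrite /mball /= => h1.
have : d l (p m).1 < e by apply: (MP m); rewrite /= leq_maxl.
have := is_metric_triangle dP (p n.+1).1 (p m).1 l.
by rewrite (is_metric_sym dP (p m).1 l); lra.
Qed.

Lemma nowhere_dense_cover_not_meetable (T : Type) (Q : set T) (N : T -> set X) :
  (forall q, Q q -> nowhere_dense (N q)) ->
  \bigcup_(q in Q) N q = [set: X] -> ~ meetable Q.
Proof.
move=> nwd cov meetQ.
have [|p [_ pS pQ]] := @meetable_run _ (c 0%N, 0%N) step _ Q
    (fun q => [set p | mball p `&` N q = set0]) meetQ.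
  by move=> q Qq W; exact: step_avoids (nwd q Qq).
have [|l lP] := @run_point p.
  by move=> n; have [i ->] := pS n; exact: step_refines.
have [q Qq Nl] : (\bigcup_(q in Q) N q) l by rewrite cov.
have [n /= n0] := pQ q Qq.
by have : (mball (p n) `&` N q) l by []; rewrite n0.
Qed.

End BallGame.

Lemma meagre_cover_not_meetable (R : realType) (X : topologicalType) (x : X)
    (T : Type) (Q : set T) (M : T -> set X) :
  polish_space R X -> (forall q, Q q -> meagre (M q)) ->
  \bigcup_(q in Q) M q = [set: X] -> ~ meetable Q.
Proof.
move=> [[S [cS dS]] [d [dP dtop dcomp]]] Mm cov /meetable_setX_nat meetQ.
have [c cS'] : exists c : nat -> X, S `<=` range c.
  move/pfcard_geP: cS => [S0|[f]]; last by exists f => y /(@surj _ _ _ _ f).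
  by have [|y []] := dS setT _ openT; [exists x|rewrite S0].
have cdense V : open V -> V !=set0 -> exists n, V (c n).
  by move=> Vo V0; have [y [Vy /cS'[n _ cn]]] := dS V V0 Vo; exists n; rewrite cn.
have /choice[F FP] : forall q, exists F : nat -> set X, Q q ->
    (forall n, nowhere_dense (F n)) /\ M q = \bigcup_n F n.
  move=> q; have [/Mm[F FP]|nQq] := pselect (Q q); first by exists F.
  by exists (fun=> set0).
apply: (@nowhere_dense_cover_not_meetable R X d c dP dtop dcomp cdense _ _
  (fun qn => F qn.1 qn.2)) meetQ.
  by move=> [q n] [/= /FP[h _] _]; exact: h.
apply/seteqP; split=> // y _.
have [q Qq] : (\bigcup_(q in Q) M q) y by rewrite cov.
by have [_ ->] := FP q Qq; move=> [n _ Fy]; exists (q, n).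
Qed.

(** * Covers of the real line *)

(* Hoenig's argument: in a maximal set of choice functions on P that pairwise
   differ everywhere, evaluation at some member of P is onto. *)
Lemma least_cardinality_exists (T : Type) (P : set (set T)) :
  P !=set0 -> exists A, least_cardinality P A.
Proof.
move=> [A0 PA0].
pose good (S : set (set T -> T)) :=
  (forall f, S f -> forall B, P B -> B (f B)) /\
  (forall f g, S f -> S g -> forall B, P B -> f B = g B -> f = g).
have [|S [[Sin Sinj] Smax]] := @Zorn_bigcup _ good.
  move=> F Fgood Ftot; split=> [f [S FS Sf]|f g [S FS Sf] [S' FS' S'g]].
    exact: (Fgood S FS).1.
  have [SS'|S'S] := Ftot _ _ FS FS'.
    by apply: (Fgood S' FS').2 => //; exact: SS'.
  by apply: (Fgood S FS).2 => //; exact: S'S.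
have [[A [PA Aonto]]|noA] := pselect (exists A, P A /\
    A `<=` [set f A | f in S]).
  exists A; split=> // B PB.
  (* Evaluation at [A] maps [S] onto [A], and evaluation at [B] embeds [S] into [B]. *)
  apply: (card_le_trans (subset_card_le Aonto)).
  apply: (card_le_trans (card_image_le _ _)).
  have Seq : [set f B | f in S] #= S.
    by apply: inj_card_eq => f g /set_mem Sf /set_mem Sg; exact: Sinj.
  move: Seq; rewrite card_eq_le => /andP[_ Sle]; apply: (card_le_trans Sle).
  by apply: subset_card_le => _ [f Sf <-]; exact: (Sin f Sf B PB).
have new B : P B -> exists2 b, B b & ~ [set f B | f in S] b.
  move=> PB; apply: contrapT => h; apply: noA; exists B; split=> // b Bb.
  by apply: contrapT => nb; apply: h; exists b.
have [t0 _ _] := new A0 PA0.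
have /choice[h hP] : forall B, exists b, P B -> B b /\ ~ [set f B | f in S] b.
  move=> B; have [/new[b]|] := pselect (P B); first by exists b.
  by exists t0.
have hS f B : S f -> P B -> f B <> h B.
  by move=> Sf PB e; have [_ []] := hP B PB; exists f.
case: (Smax (S `|` [set h])).
  split=> [f Sf|/(_ h (or_intror erefl)) Sh]; first by left.
  by case: (hS h A0 Sh PA0).
split=> [f [Sf|->] B PB|f g [Sf|->] [Sg|->] B PB].
- exact: (Sin f Sf B PB).
- by have [] := hP B PB.
- exact: (Sinj f g Sf Sg B PB).
- by move=> /(hS _ _ Sf PB).
- by move=> /esym /(hS _ _ Sg PB).
- by [].
Qed.

Lemma open_dense_nowhere_denseC (X : topologicalType) (U : set X) :
  open U -> dense U -> nowhere_dense (~` U).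
Proof.
move=> Uo Ud; rewrite /nowhere_dense.
have /closure_id <- : closed (~` U) by exact: open_closedC.
apply/seteqP; split=> // x Ix.
have [y [/interior_subset nUy Uy]] := Ud _ (ex_intro _ x Ix) (open_interior _).
exact: nUy.
Qed.

Lemma nowhere_dense_meagre (X : topologicalType) (N : set X) :
  nowhere_dense N -> meagre N.
Proof.
move=> nwd; exists (fun=> N); split=> //.
by apply/seteqP; split=> [x Nx|x [_ _]//]; exists 0%N.
Qed.

Lemma real_polish (R : realType) : polish_space R R.
Proof.
split.
  exists (range ratr); split; last exact: dense_rat.
  exact: card_le_trans (card_image_le _ _) (countableP _).
exists (fun x y => `|x - y|); split.
- split=> [x y|x y|x y|x y z]; first exact: normr_ge0.
  + split=> [/eqP|->]; last by rewrite subrr normr0.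
    by rewrite normr_eq0 subr_eq0 => /eqP.
  + exact: distrC.
  + by have := ler_normD (x - y) (y - z); rewrite addrA subrK.
- by move=> x; apply/funext => V; apply: propext; exact: (nbhs_normP x V).
- move=> u uC; apply/cvg_ex; apply: cauchy_cvg; apply: cauchy_exP => e e0.
  have [N NP] := uC e e0; exists (u N); exists N => // n /= Nn.
  by rewrite -ball_normE /=; exact: NP.
Qed.

Lemma not_meetableP (T : Type) (Q : set T) : ~ meetable Q ->
  exists Phi : T -> nat -> nat, forall g : nat -> nat,
    exists2 q, Q q & forall k, g k <> Phi q k.
Proof.
move=> /existsNP[Phi PhiP]; exists Phi => g.
apply: contrapT => h; apply: PhiP; exists g => q Qq.
by apply: contrapT => hk; apply: h; exists q => // k gk; apply: hk; exists k.
Qed.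

(** No function agrees anywhere with its successor. This supplies some cover of the reals by meagre
    sets, so that a least one exists. *)
Lemma not_meetable_funs : ~ meetable [set: nat -> nat].
Proof.
by move=> /(_ id)[g /(_ (fun k => (g k).+1) I)[k]]; lia.
Qed.

(** A point lies in [O k m] for at most one [m]. Guess this [m] for every [k]: some [Phi q] never
    agrees with the guess, so the point avoids the dense open set built from [Phi q]. *)
Lemma not_meetable_real_cover (R : realType) (T : Type) (Q : set T) :
  ~ meetable Q ->
  exists2 F : set (set R), (forall N, F N -> meagre N) /\
    \bigcup_(N in F) N = [set: R] & F #<= Q.
Proof.
move=> /not_meetableP[Phi PhiP].
(* If k codes (a, j), the O k m are disjoint subintervals of ]a, a + 1/(j+1)[. *)
pose O k m : set R := if unpickle k is Some (a, j) then
  [set x | ratr a + j.+1%:R^-1 * m.+2%:R^-1 < x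
         < ratr a + j.+1%:R^-1 * m.+1%:R^-1] else set0.
have O_open k m : open (O k m).
  rewrite /O; case: unpickle => [[a j]|]; last exact: open0.
  by rewrite -set_itvoo; exact: itv_open.
have O_lt k m n x : (m < n)%N -> O k m x -> ~ O k n x.
  rewrite /O; case: unpickle => // -[a j] mn /= /andP[x1 _] /andP[_ x2].
  have : (j.+1%:R^-1 * n.+1%:R^-1 <= j.+1%:R^-1 * m.+2%:R^-1 :> R).
    by rewrite ler_pM2l ?invr_gt0 ?ltr0n // lef_pV2 ?posrE ?ltr0n // ler_nat.
  by have := lt_trans x1 x2; rewrite ltrD2l ltNge => /negbTE ->.
have O_inj k m n x : O k m x -> O k n x -> m = n.
  by move=> h1 h2; case: (ltngtP m n) => // /O_lt h; [case: (h k x h1)|case: (h k x h2)].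
have O_dense (e : nat -> nat) : dense (\bigcup_k O k (e k)).
  move=> V [x Vx] Vo.
  have /nbhs_normP[r /= r0 rV] : nbhs x V by exact: open_nbhs_nbhs.
  (* With [a] less than [r / 2] to the left of [x] and [1/(j+1) < r / 2], all intervals coded by
     [(a, j)] lie within [r] of [x], whatever [e] picks. *)
  have [j _ /(_ j (leqnn j)) /= jr] := near_infty_natSinv_lt (PosNum (divr_gt0 r0 (ltr0Sn R 1))).
  have [a] : exists a : rat, ratr a \in `](x - r / 2), x[.
    by apply: rat_in_itvoo; lra.
  rewrite in_itv /= => /andP[a1 a2].
  set m := e (pickle (a, j)).
  have j0 : (0 < j.+1%:R^-1 :> R) by rewrite invr_gt0 ltr0n.
  have mm : j.+1%:R^-1 * m.+2%:R^-1 < j.+1%:R^-1 * m.+1%:R^-1 :> R.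
    by rewrite ltr_pM2l // ltf_pV2 ?posrE ?ltr0n // ltr_nat.
  have m0 : (0 < j.+1%:R^-1 * m.+2%:R^-1 :> R).
    by rewrite mulr_gt0 // invr_gt0 ltr0n.
  have m1 : j.+1%:R^-1 * m.+1%:R^-1 <= j.+1%:R^-1 :> R.
    by rewrite ler_piMr ?(ltW j0) // invf_le1 ?ltr0n // ler1n.
  have mid (al u v w : R) : 0 < u -> u < v -> v <= w -> w < r / 2 ->
      x - r / 2 < al -> al < x ->
      exists y, `|x - y| < r /\ al + u < y < al + v.
    move=> *; exists (al + (u + v) / 2).
    by rewrite ltr_norml; split; [apply/andP; split; lra|apply/andP; split; lra].
  have [y [xy Oy]] := mid _ _ _ _ m0 mm m1 jr a1 a2.
  exists y; split; first exact: rV.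
  exists (pickle (a, j)); first exact: I.
  by rewrite /O pickleK; exact: Oy.
pose M q : set R := ~` \bigcup_k O k (Phi q k).
exists [set M q | q in Q]; last exact: card_image_le.
split=> [_ [q _ <-]|].
  apply/nowhere_dense_meagre/open_dense_nowhere_denseC => //.
  by apply: bigcup_open => k _; exact: O_open.
apply/seteqP; split=> // x _.
have [q Qq qP] := PhiP (fun k => xget 0%N [set m | O k m x]).
exists (M q) => /=; first by exists q.
move=> [k _ Okx]; apply: (qP k).
by case: xgetP => [m _ /O_inj|/(_ _ Okx)//]; exact.
Qed.

(** * Covering the group *)

Section Tree.
Variable T : set (seq nat).
Hypotheses (Ttree : is_tree T) (T0 : T !=set0) (Tinf : infinite_branching T).

(* The node t is unknown when d is applied, so d has to suit all t at once. *)
Lemma infinite_branching_decoder :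
  exists d : nat -> nat, forall t m, T t -> exists n, T (rcons t n) /\ d n = m.
Proof.
have /choice[E EP] : forall x : nat * seq nat, exists E : seq nat, T x.2 ->
    [/\ uniq E, (x.1 < size E)%N & forall n, n \in E -> T (rcons x.2 n)].
  move=> [k t] /=; have [Tt|] := pselect (T t); last by exists [::].
  have [B BT kB] := infinite_set_fset k.+1 (Tinf Tt).
  by exists (finmap.enum_fset B) => _; split=> [|//|n nB]; [exact: finmap.fset_uniq|exact: BT].
(* For [t] in [T] and [k] the code of [(t, m)], more than [k] successors of [t] compete to be
   decoded as [m], as [distinct_representatives] needs. *)
pose L k : seq (nat * nat) := if unpickle k is Some (t, m)
  then [seq (n, m) | n <- E (k, t)] else [::].
have [d dP] := distinct_representatives L.
exists d => t m Tt; pose k := pickle (t, m).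
have Lk : L k = [seq (n, m) | n <- E (k, t)] by rewrite /L pickleK.
have [uE sE ET] := EP (k, t) Tt.
have [||p] := dP k.
- by rewrite Lk /unzip1 -map_comp map_id_in.
- by rewrite Lk size_map.
by rewrite Lk => /mapP[n /ET Tn ->] /= dn; exists n.
Qed.

(** Climbing [T] through successors with prescribed decoded values makes branches as free as
    arbitrary functions. *)
Lemma tree_body_decode :
  exists d : nat -> nat, forall phi : nat -> nat,
    exists2 b, tree_body T b & forall k, d (b k) = phi k.
Proof.
have [d dP] := infinite_branching_decoder.
exists d => phi.
have /choice[nxt nxtP] : forall tm : seq nat * nat, exists n,
    T tm.1 -> T (rcons tm.1 n) /\ d n = tm.2.
  move=> [t m]; have [/(dP t m)[n nP]|] := pselect (T t); first by exists n.
  by exists 0%N.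
pose s := fix s k := if k is j.+1 then rcons (s j) (nxt (s j, phi j)) else [::].
have Ts k : T (s k).
  elim: k => [|k IH] /=; last by have [] := nxtP (s k, phi k) IH.
  by have [t Tt] := T0; apply: Ttree Tt; exact: prefix0s.
pose b k := nxt (s k, phi k).
have sE k : mkseq b k = s k by elim: k => // k IH; rewrite mkseqS IH.
exists b => k; first by rewrite sE.
by have [] := nxtP (s k, phi k) (Ts k).
Qed.

End Tree.

Lemma not_meetable_group_cover (G : topologicalGroupType)
    (B : nat -> set G) (A : nat -> nat -> set G) (T : set (seq nat))
    (S : Type) (F : set S) :
  is_tree T -> T !=set0 -> infinite_branching T ->
  (forall b : nat -> nat, tree_body T b -> \bigcap_k A k (b k) !=set0) ->
  open (\bigcup_k B k) -> dense (\bigcup_k B k) ->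
  (forall k i j : nat, i <> j ->
    set_mulg (A k i) (B k) `&` set_mulg (A k j) (B k) = set0) ->
  ~ meetable F ->
  exists2 Q : set G, exists C : set G,
    [/\ closed C, nowhere_dense C & set_mulg Q C = [set: G]] & Q #<= F.
Proof.
move=> Ttree T0 Tinf TA Bo Bd hAB /not_meetableP[Phi PhiP].
have [d dP] := tree_body_decode Ttree T0 Tinf.
have /choice[x xP] : forall s, exists x : G,
    exists2 b : nat -> nat, forall k, A k (b k) x & forall k, d (b k) = Phi s k.
  move=> s; have [b Tb bP] := dP (Phi s); have [x xA] := TA b Tb.
  by exists x; exists b => // k; exact: xA.
exists [set x s | s in F]; last exact: card_image_le.
exists (~` \bigcup_k B k); split.
- exact: open_closedC.
- exact: open_dense_nowhere_denseC.
apply/seteqP; split=> // g _.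
have [s Fs sP] :=
  PhiP (fun k => d (xget 0%N [set i | set_mulg (A k i) (B k) g])).
exists (x s); first by exists s.
exists ((x s)^-1 * g)%g; last by rewrite mulVKg.
(* If [(x s)^-1 * g] is in [B k], then [g] lies in [A k (b k) * B k]; by disjointness the guess at
   [k] decodes [b k], hence equals [Phi s k]. *)
move=> [k _ Bk]; apply: (sP k).
have [b bA bPhi] := xP s; rewrite -bPhi; congr d.
have gk : set_mulg (A k (b k)) (B k) g.
  by exists (x s) => //; exists ((x s)^-1 * g)%g => //; rewrite mulVKg.
case: xgetP => [i _ gi|/(_ _ gk)//].
apply: contrapT => /(hAB k) ib.
by have : (set_mulg (A k i) (B k) `&` set_mulg (A k (b k)) (B k)) g by []; rewrite ib.
Qed.

(** * Translates of nowhere dense sets *)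

Lemma mulg_continuousl (G : topologicalGroupType) (q : G) :
  continuous (fun x : G => (q * x)%g).
Proof.
move=> x; apply: (@cvg_comp _ _ _ (fun y => (q, y)) (fun xy : G * G => (xy.1 * xy.2)%g)
  _ (nbhs (q, x))); last exact: (mulg_continuous (q, x)).
by apply: cvg_pair; [exact: cvg_cst|exact: cvg_id].
Qed.

Lemma nowhere_dense_translate (G : topologicalGroupType) (q : G) (C : set G) :
  closed C -> nowhere_dense C -> nowhere_dense [set (q * c)%g | c in C].
Proof.
move=> Cc; rewrite /nowhere_dense -(closure_id C).1 // => Cn.
have -> : [set (q * c)%g | c in C] = (fun x => (q^-1 * x)%g) @^-1` C.
  apply/seteqP; split=> [_ [c Cc' <-]|x Cx] /=; first by rewrite mulKg.
  by exists (q^-1 * x)%g => //; rewrite mulVKg.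
rewrite -(closure_id _).1; last first.
  by apply: closed_comp Cc => x _; exact: mulg_continuousl.
apply/seteqP; split=> // x Ix; rewrite -Cn.
set D := (fun x => (q^-1 * x)%g) @^-1` C in Ix.
have Do : open ((fun y => (q * y)%g) @^-1` D°).
  by apply: open_comp (open_interior _) => y _; exact: mulg_continuousl.
have sub : (fun y => (q * y)%g) @^-1` D° `<=` C.
  by move=> y /= /interior_subset; rewrite /D /= mulKg.
suff: (C°) (q^-1 * x)%g by rewrite Cn.
move: sub; rewrite (open_subsetE _ Do); apply; rewrite /= mulVKg.
exact: Ix.
Qed.

Lemma group_cover_not_meetable (R : realType) (G : topologicalGroupType)
    (Q C : set G) :
  polish_space R G -> closed C -> nowhere_dense C ->
  set_mulg Q C = [set: G] -> ~ meetable Q.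
Proof.
move=> polG Cc Cn QC.
apply: (@meagre_cover_not_meetable R G 1%g _ Q
  (fun q => [set (q * c)%g | c in C]) polG).
  by move=> q _; exact/nowhere_dense_meagre/nowhere_dense_translate.
apply/seteqP; split=> // g _.
have : set_mulg Q C g by rewrite QC.
by move=> [q Qq [c Cc' <-]]; exists q => //; exists c.
Qed.

Theorem theorem7 (R : realType) (G : topologicalGroupType)
    (polishG : polish_space R G)
    (B : nat -> set G) (A : nat -> nat -> set G)
    (hT : exists T : set (seq nat),
        [/\ is_tree T, T !=set0, infinite_branching T &
            forall b : nat -> nat, tree_body T b ->
              \bigcap_k A k (b k) !=set0])
    (hB : open (\bigcup_k B k) /\ dense (\bigcup_k B k))
    (hAB : forall k i j : nat, i <> j ->
        set_mulg (A k i) (B k) `&` set_mulg (A k j) (B k) = set0) :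
  exists (Q : set G) (F : set (set R)),
    [/\ is_cov_group Q, is_cov_meagre F & Q #= F].
Proof.
have [T [Ttree T0 Tinf TA]] := hT; have [Bo Bd] := hB.
have [F0 F0P _] := not_meetable_real_cover R not_meetable_funs.
have [F [[Fm Fcov] Fmin]] : exists F : set (set R), is_cov_meagre F.
  by apply: least_cardinality_exists; exists F0.
have Fnm : ~ meetable F.
  exact: (@meagre_cover_not_meetable R R 0 _ F id (real_polish R)).
have [Q QP QF] := not_meetable_group_cover Ttree T0 Tinf TA Bo Bd hAB Fnm.
(* Every covering [Q'] yields a meagre cover of the reals no larger than [Q'], hence [F #<= Q']; as
   [Q #<= F], the set [Q] is least too. *)
have FQ Q' : (exists C : set G,
    [/\ closed C, nowhere_dense C & set_mulg Q' C = [set: G]]) -> F #<= Q'.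
  move=> [C [Cc Cn /(group_cover_not_meetable polishG Cc Cn)]].
  move=> /(not_meetable_real_cover R)[F' F'P]; apply: card_le_trans.
  exact: Fmin.
exists Q, F; split=> //.
  by split=> // Q' /FQ; exact: card_le_trans.
by rewrite card_eq_le QF FQ.
Qed.
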